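(* Let $X$ be a tensor 1-representable regular poly-bicategory. Then, for a 1-cell $e: x \to y$ of $X$, the following are equivalent: 1. $e$ is tensor universal; 2. there exist tensor units $1_x$ on $x$ and $1_y$ on $y$, a 1-cell $e^*: y \to x$, and 2-cells exhibiting $e \otimes e^* \simeq 1_x$ and $e^* \otimes e \simeq 1_y$, that is, 2-cells $(e,e^* )\to(1_x)$ and $(e^*,e)\to(1_y)$ both universal at $\partial_1^+$.
   Context: A regular 2-polygraph $X$ consists of a set of 0-cells, a set of 1-cells $a: x \to y$ (each with a source and a target 0-cell), and, for all $n,m\ge 1$, a set of 2-cells $p:(a_1,\ldots,a_n)\to(b_1,\ldots,b_m)$, whose input $(a_i)$ and output $(b_j)$ are non-empty composable sequences of 1-cells (the target of each is the source of the next) with the same initial source and the same final target; write $\partial_i^-p=a_i$, $\partial_j^+p=b_j$. Greek capitals denote possibly empty composable sequences of 1-cells, and commas denote concatenation. A (non-unital) regular poly-bicategory is a regular 2-polygraph with operations $\mathrm{cut}_{j,i}$: given $t:(\Gamma)\to(\Delta_1,a,\Delta_2)$ and $s:(\Gamma_1,a,\Gamma_2)\to(\Delta)$, where the displayed $a$ is the $j$-th output of $t$ and the $i$-th input of $s$, such that ($\Gamma_1$ or $\Delta_1$ is empty) and ($\Gamma_2$ or $\Delta_2$ is empty), there is a composite 2-cell $\mathrm{cut}_{j,i}(t,s):(\Gamma_1,\Gamma,\Gamma_2)\to(\Delta_1,\Delta,\Delta_2)$. These satisfy associativity and interchange: whenever three 2-cells can be composed by two cuts, along the same two identified 1-cells,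 in two different orders, the two results are equal (e.g. $\mathrm{cut}_{j,1}(t,\mathrm{cut}_{i,1}(s,r))=\mathrm{cut}_{i+j-1,1}(\mathrm{cut}_{j,1}(t,s),r)$). No unit cells are part of the structure. Universality. A 2-cell $t:(\Gamma)\to(\Delta_1,a,\Delta_2)$, with $a$ in $j$-th position, is universal at $\partial_j^+$ if for all $\Gamma_1,\Gamma_2$ and non-empty $\Delta$ with ($\Gamma_1$ or $\Delta_1$ empty) and ($\Gamma_2$ or $\Delta_2$ empty), every 2-cell $s:(\Gamma_1,\Gamma,\Gamma_2)\to(\Delta_1,\Delta,\Delta_2)$ equals $\mathrm{cut}(t,r)$, composed along $a$, for a unique $r:(\Gamma_1,a,\Gamma_2)\to(\Delta)$. Dually, $t:(\Gamma_1,a,\Gamma_2)\to(\Delta)$, with $a$ in $i$-th position, is universal at $\partial_i^-$ if for all $\Delta_1,\Delta_2$ and non-empty $\Gamma$ with ($\Gamma_1$ or $\Delta_1$ empty) and ($\Gamma_2$ or $\Delta_2$ empty), every $s:(\Gamma_1,\Gamma,\Gamma_2)\to(\Delta_1,\Delta,\Delta_2)$ equals $\mathrm{cut}(r,t)$, composed along $a$, for a unique $r:(\Gamma)\to(\Delta_1,a,\Delta_2)$. A unit on a 1-cell $a$ is a 2-cell $\mathrm{id}_a:(a)\to(a)$ such that every cut with $\mathrm{id}_a$, on either side, returns the other 2-cell. $X$ is unital if every 1-cell has a unit. $X$ is tensor 1-representable if it is unital and for all 1-cells $a: x\to y$, $b:y\to z$ there exist a 1-cell $a\otimes b: x\to z$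 and a 2-cell (a tensor) $(a,b)\to(a\otimes b)$ universal at $\partial_1^+$. Tensor units. A 1-cell $1_x: x\to x$ is a tensor unit on $x$ if for each 1-cell $a: x\to y$ there is a 2-cell $l_a:(1_x,a)\to(a)$ universal at both $\partial_1^+$ and $\partial_2^-$, and for each 1-cell $b:z\to x$ there is a 2-cell $r_b:(b,1_x)\to(b)$ universal at both $\partial_1^+$ and $\partial_1^-$. Tensor universality. Let $e: x \to x'$ be a 1-cell. It is tensor left universal if for each 1-cell $a: x\to y$ there exist a 1-cell $u: x'\to y$ and a 2-cell $(e,u)\to(a)$ universal at both $\partial_1^+$ and $\partial_2^-$, and for each 1-cell $a':x'\to y$ there exist a 1-cell $v: x\to y$ and a 2-cell $(e,a')\to(v)$ universal at both $\partial_1^+$ and $\partial_2^-$. It is tensor right universal if for each $b': z\to x'$ there exist $u: z\to x$ and a 2-cell $(u,e)\to(b')$ universal at both $\partial_1^+$ and $\partial_1^-$, and for each $b:z\to x$ there exist $v: z\to x'$ and a 2-cell $(b,e)\to(v)$ universal at both $\partial_1^+$ and $\partial_1^-$. It is tensor universal if it is both tensor left and tensor right universal. *)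

(* Defs.v *)
From mathcomp Require Import all_boot.

Set Implicit Arguments.
Unset Strict Implicit.
Unset Printing Implicit Defensive.

Section CompositeSequences.
Variables (C0 C1 : Type) (src tgt : C1 -> C0).

(* The empty sequence is composable from x to y only when x = y. *)
Fixpoint composable (x : C0) (l : seq C1) (y : C0) : Prop :=
  if l is a :: l' then src a = x /\ composable (tgt a) l' y else x = y.

End CompositeSequences.

Record polygraph := Polygraph {
  cell0 : Type;
  cell1 : Type;
  cell2 : Type;
  src : cell1 -> cell0;
  tgt : cell1 -> cell0;
  inp : cell2 -> seq cell1;
  outp : cell2 -> seq cell1;
  inp_neq0 : forall p, inp p <> [::];
  outp_neq0 : forall p, outp p <> [::];
  boundaryP : forall p, exists x y,
    composable src tgt x (inp p) y /\ composable src tgt x (outp p) y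
}.

Section PolygraphCells.
Variable P : polygraph.

Definition is_cell1 (a : cell1 P) (x y : cell0 P) : Prop :=
  src a = x /\ tgt a = y.

Definition is_cell2 (p : cell2 P) (G D : seq (cell1 P)) : Prop :=
  inp p = G /\ outp p = D.

End PolygraphCells.

Definition planar (T : Type) (G1 G2 D1 D2 : seq T) : Prop :=
  (G1 = [::] \/ D1 = [::]) /\ (G2 = [::] \/ D2 = [::]).

(* All positions in inputs and outputs are counted from 0: the j-th position
   below is the (j+1)-th one in the usual, 1-based, numbering. *)
Definition cuttable (P : polygraph) (j i : nat) (t s : cell2 P) : Prop :=
  exists a G1 G2 D1 D2,
    [/\ outp t = D1 ++ a :: D2, inp s = G1 ++ a :: G2,
        size D1 = j, size G1 = i & planar G1 G2 D1 D2].

(* [cut j i t s] identifies the output j of t with the input i of s.  The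
   operation is partial: its value is unconstrained, and never used, when
   [cuttable j i t s] fails.  The three equations are the three shapes of a
   composite of three 2-cells along two 1-cells, according to whether the
   2-cell touching both 1-cells has one of them as an output and one as an
   input, both as inputs, or both as outputs; each is required as soon as both
   orders of composition are defined. *)
Record polybicategory := Polybicategory {
  underlying :> polygraph;
  cut : nat -> nat -> cell2 underlying -> cell2 underlying -> cell2 underlying;
  cut_boundary : forall t s a G G1 G2 D D1 D2,
    is_cell2 t G (D1 ++ a :: D2) -> is_cell2 s (G1 ++ a :: G2) D ->
    planar G1 G2 D1 D2 ->
    is_cell2 (cut (size D1) (size G1) t s) (G1 ++ G ++ G2) (D1 ++ D ++ D2);
  cut_assoc : forall j i l k t s r,
    cuttable l k s r -> cuttable j (k + i) t (cut l k s r) ->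
    cuttable j i t s -> cuttable (j + l) k (cut j i t s) r ->
    cut j (k + i) t (cut l k s r) = cut (j + l) k (cut j i t s) r;
  cut_interchange_inp : forall j i l k t s r, i < k ->
    cuttable l k s r -> cuttable j i t (cut l k s r) ->
    cuttable j i t r -> cuttable l (k + size (inp t)).-1 s (cut j i t r) ->
    cut j i t (cut l k s r) = cut l (k + size (inp t)).-1 s (cut j i t r);
  cut_interchange_outp : forall j i l k t s r, j < l ->
    cuttable l k t r -> cuttable j i (cut l k t r) s ->
    cuttable j i t s -> cuttable (l + size (outp s)).-1 k (cut j i t s) r ->
    cut j i (cut l k t r) s = cut (l + size (outp s)).-1 k (cut j i t s) r
}.

Section Universality.
Variable X : polybicategory.

Definition universal_out (j : nat) (t : cell2 X) : Prop :=
  exists D1 a D2, [/\ outp t = D1 ++ a :: D2, size D1 = j &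
    forall G1 G2 D, D <> [::] -> planar G1 G2 D1 D2 ->
    forall s, is_cell2 s (G1 ++ inp t ++ G2) (D1 ++ D ++ D2) ->
    exists! r, is_cell2 r (G1 ++ a :: G2) D /\ s = cut j (size G1) t r].

Definition universal_inp (i : nat) (t : cell2 X) : Prop :=
  exists G1 a G2, [/\ inp t = G1 ++ a :: G2, size G1 = i &
    forall D1 D2 G, G <> [::] -> planar G1 G2 D1 D2 ->
    forall s, is_cell2 s (G1 ++ G ++ G2) (D1 ++ outp t ++ D2) ->
    exists! r, is_cell2 r G (D1 ++ a :: D2) /\ s = cut (size D1) i r t].

Definition is_unit (a : cell1 X) (u : cell2 X) : Prop :=
  [/\ is_cell2 u [:: a] [:: a],
      forall j t, cuttable j 0 t u -> cut j 0 t u = t &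
      forall i s, cuttable 0 i u s -> cut 0 i u s = s].

Definition unital : Prop := forall a, exists u, is_unit a u.

Definition tensor_representable1 : Prop :=
  unital /\
  forall x y z a b, is_cell1 a x y -> is_cell1 b y z ->
  exists ab t, [/\ is_cell1 ab x z, is_cell2 t [:: a; b] [:: ab] &
                   universal_out 0 t].

Definition tensor_unit (x : cell0 X) (u : cell1 X) : Prop :=
  [/\ is_cell1 u x x,
      forall y a, is_cell1 a x y ->
        exists l, [/\ is_cell2 l [:: u; a] [:: a],
                      universal_out 0 l & universal_inp 1 l] &
      forall z b, is_cell1 b z x ->
        exists r, [/\ is_cell2 r [:: b; u] [:: b],
                      universal_out 0 r & universal_inp 0 r]].

Definition tensor_left_universal (e : cell1 X) : Prop :=
  (forall y a, is_cell1 a (src e) y ->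
     exists u p, [/\ is_cell1 u (tgt e) y, is_cell2 p [:: e; u] [:: a],
                     universal_out 0 p & universal_inp 1 p]) /\
  (forall y a', is_cell1 a' (tgt e) y ->
     exists v p, [/\ is_cell1 v (src e) y, is_cell2 p [:: e; a'] [:: v],
                     universal_out 0 p & universal_inp 1 p]).

Definition tensor_right_universal (e : cell1 X) : Prop :=
  (forall z b', is_cell1 b' z (tgt e) ->
     exists u p, [/\ is_cell1 u z (src e), is_cell2 p [:: u; e] [:: b'],
                     universal_out 0 p & universal_inp 0 p]) /\
  (forall z b, is_cell1 b z (src e) ->
     exists v p, [/\ is_cell1 v z (tgt e), is_cell2 p [:: b; e] [:: v],
                     universal_out 0 p & universal_inp 0 p]).

Definition tensor_universal (e : cell1 X) : Prop :=
  tensor_left_universal e /\ tensor_right_universal e.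

End Universality.

Arguments tensor_representable1 : clear implicits.

(* Main.v *)
Require Import Defs.
From mathcomp Require Import all_boot zify.

Set Implicit Arguments.
Unset Strict Implicit.
Unset Printing Implicit Defensive.

(** The theorem is the poly-bicategorical form of the fact that an element of a
semigroup by which one can divide on both sides produces a unit and has an
inverse, and conversely.

From universality to an inverse. Right universality of [e : x -> y], applied
to [e] itself, gives a cell [p : (u, e) -> (e)] universal at its output. The
point is that such a cell already makes [u] a tensor unit
([tensor_unit_of_absorbed]): any [a] out of [x] has the form [e * c], so [p]
transports to [l : (u, a) -> (a)]; any [b] into [x] has a tensor [b * e], in
which the [u] of [(b, u, e)] can be absorbed on the right and then moved to
the left by cancelling [e], giving [r : (b, u) -> (b)]. The universal
properties of [l] and [r] concern arbitrary contexts, but contexts where [e]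
occurs next to [u] suffice, because [e] can be inserted in and removed from
any context ([universal_out_test]); in these contexts [l] and [r] agree with
[p]. By symmetry a unit [u'] on [y] comes from [p' : (e, u') -> (e)]. Right
universality now divides [u'] by [e], which gives [q : (e', e) -> (u')], and
factoring [(e, e', e) -> (e, u') -> (e)] through [p] gives [(e, e') -> (u)],
universal by the same test ([inverse_of_universal]).

From an inverse to universality. For a 1-cell [a] out of [x], let [b] be [e' *
a]; contracting [(e, e')] gives [h : (e, b) -> (a)], and its output
universality follows from cancellation. The real question is universality at
the input [b]. The two cells [h : (e, b) -> (a)] and [t : (e', a) -> (b)],
both universal at their outputs, are essentially inverse to each other: their
two composites are the contractions [(e', e) -> (uy)] and [(e, e') -> (ux)]
followed by cells [(uy, b) -> (b)] and [(ux, a) -> (a)] universal at their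
outputs. The latter need not be the chosen left unitors, but they differ from
these by invertible cells, hence are universal at the last input as well
([unit_universal_inp]). So composing with [h] and then [t] is bijective, and
likewise with [t] and then [h]; hence composing with [h] alone is bijective
([inverse_cell_universal_inp]).

Only left universality is proved this way: reversing all 1-cells and all
sequences turns a poly-bicategory into another one ([mirror]), which exchanges
left and right. *)

(** * Composable sequences and boundaries *)

Section Composable.
Variables (C0 C1 : Type) (src tgt : C1 -> C0).

Lemma composable_cat x y l1 l2 :
  composable src tgt x (l1 ++ l2) y <->
  exists z, composable src tgt x l1 z /\ composable src tgt z l2 y.
Proof.
elim: l1 x => [|a l1 IH] x /=.
  by split=> [h|[z [-> h]]//]; exists x.
split=> [[<- /IH[z [h1 h2]]]|[z [[<- h1] h2]]]; first by exists z.
by split=> //; apply/IH; exists z.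
Qed.

End Composable.

Lemma composable_rev C0 C1 (src tgt : C1 -> C0) x y l :
  composable src tgt x l y <-> composable tgt src y (rev l) x.
Proof.
elim: l x y => [|a l IH] x y /=; first by split=> ->.
rewrite rev_cons -cats1; split.
  by move=> [<- h]; apply/composable_cat; exists (tgt a); split; [apply/IH|].
by move/composable_cat=> [z [/IH h /= [h1 h2]]]; rewrite h1 h2.
Qed.

Section Boundary.
Variable P : polygraph.
Implicit Types (p : cell2 P) (a b : cell1 P) (A D G : seq (cell1 P)).

Lemma cell2_boundary p G D : is_cell2 p G D -> exists x y,
  composable (@src P) (@tgt P) x G y /\ composable (@src P) (@tgt P) x D y.
Proof. by move=> [<- <-]; apply: boundaryP. Qed.

Lemma cell2_outp_neq0 p G D : is_cell2 p G D -> D <> [::].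
Proof. by move=> [_ <-]; apply: outp_neq0. Qed.

Lemma cell2_inp_neq0 p G D : is_cell2 p G D -> G <> [::].
Proof. by move=> [<- _]; apply: inp_neq0. Qed.

Lemma inp_adjacent p G1 a b G2 D :
  is_cell2 p (G1 ++ a :: b :: G2) D -> tgt a = src b.
Proof.
move=> /cell2_boundary[x [y [h _]]].
by have [z [_ /= [_ [-> _]]]] := (composable_cat _ _ _ _ _ _).1 h.
Qed.

Lemma src_boundary p a G b D : is_cell2 p (a :: G) (b :: D) -> src a = src b.
Proof. by move=> /cell2_boundary[x [y [/= [-> _] [-> _]]]]. Qed.

Lemma tgt_boundary p G a D b :
  is_cell2 p (G ++ [:: a]) (D ++ [:: b]) -> tgt a = tgt b.
Proof.
move=> /cell2_boundary[x [y [hG hD]]].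
have [_ [_ [_ ->]]] := (composable_cat _ _ _ _ _ _).1 hG.
by have [_ [_ [_ ->]]] := (composable_cat _ _ _ _ _ _).1 hD.
Qed.

Lemma composite_inp_src p q A b G1 g G2 D : is_cell2 p A [:: b] ->
  is_cell2 q (G1 ++ A ++ g :: G2) D -> src g = tgt b.
Proof.
case/lastP: A => [/cell2_inp_neq0//|A a]; rewrite -cats1 -catA.
move=> /(tgt_boundary (D := [::])) <-; rewrite catA => hq.
by rewrite (inp_adjacent hq).
Qed.

Lemma composite_outp_tgt p q A b G1 D d : is_cell2 p A [:: b] ->
  is_cell2 q (G1 ++ A) (D ++ [:: d]) -> tgt d = tgt b.
Proof.
case/lastP: A => [/cell2_inp_neq0//|A a]; rewrite -cats1 catA.
by move=> /(tgt_boundary (D := [::])) <- /tgt_boundary.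
Qed.

End Boundary.

(** * Cuts in explicit contexts *)

Section Cuts.
Variable X : polybicategory.
Implicit Types (t s r k l p q h : cell2 X) (a b c d e u : cell1 X).
Implicit Types (A B D E F G K R S : seq (cell1 X)).

Lemma planar0 G1 G2 : @planar (cell1 X) G1 G2 [::] [::].
Proof. by split; right. Qed.
Hint Resolve planar0 : core.

Lemma cuttableI t s a A F G1 G2 D1 D2 :
  is_cell2 t A (D1 ++ a :: D2) -> is_cell2 s (G1 ++ a :: G2) F ->
  planar G1 G2 D1 D2 -> cuttable (size D1) (size G1) t s.
Proof. by move=> [_ ht] [hs _] pl; exists a, G1, G2, D1, D2. Qed.

Lemma cut_assocE t s r a b A D1 D2 S1 S2 E1 E2 R1 R2 F :
  is_cell2 t A (D1 ++ a :: D2) -> is_cell2 s (S1 ++ a :: S2) (E1 ++ b :: E2) ->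
  is_cell2 r (R1 ++ b :: R2) F ->
  planar S1 S2 D1 D2 -> planar R1 R2 E1 E2 ->
  planar (R1 ++ S1) (S2 ++ R2) D1 D2 -> planar R1 R2 (D1 ++ E1) (E2 ++ D2) ->
  cut (size D1) (size R1 + size S1) t (cut (size E1) (size R1) s r) =
  cut (size D1 + size E1) (size R1) (cut (size D1) (size S1) t s) r.
Proof.
move=> ht hs hr p1 p2 p3 p4.
have hsr : is_cell2 (cut (size E1) (size R1) s r)
    ((R1 ++ S1) ++ a :: S2 ++ R2) (E1 ++ F ++ E2).
  by have := cut_boundary hs hr p2; rewrite -!catA.
have hts : is_cell2 (cut (size D1) (size S1) t s)
    (S1 ++ A ++ S2) ((D1 ++ E1) ++ b :: E2 ++ D2).
  by have := cut_boundary ht hs p1; rewrite -!catA.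
apply: cut_assoc; rewrite -?size_cat.
- exact: cuttableI hs hr p2.
- exact: cuttableI ht hsr p3.
- exact: cuttableI ht hs p1.
- exact: cuttableI hts hr p4.
Qed.

Lemma cut_interchangeE t s r a b A B D1 D2 E1 E2 R1 R2 R3 F :
  is_cell2 t A (D1 ++ a :: D2) -> is_cell2 s B (E1 ++ b :: E2) ->
  is_cell2 r (R1 ++ a :: R2 ++ b :: R3) F ->
  planar R1 (R2 ++ b :: R3) D1 D2 -> planar (R1 ++ a :: R2) R3 E1 E2 ->
  planar R1 (R2 ++ B ++ R3) D1 D2 -> planar (R1 ++ A ++ R2) R3 E1 E2 ->
  cut (size D1) (size R1) t (cut (size E1) (size R1 + (size R2).+1) s r) =
  cut (size E1) (size R1 + size A + size R2) s (cut (size D1) (size R1) t r).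
Proof.
move=> ht hs hr p1 p2 p3 p4.
have hr' : is_cell2 r ((R1 ++ a :: R2) ++ b :: R3) F by rewrite -catA.
have := cut_boundary ht hr p1; have := cut_boundary hs hr' p2.
rewrite -!catA cat_cons => hsr htr.
have e1 : size R1 + size A + size R2 = size (R1 ++ A ++ R2).
  by rewrite !size_cat addnA.
have e2 : size R1 + (size R2).+1 = size (R1 ++ a :: R2) by rewrite size_cat.
have e3 : size (R1 ++ A ++ R2) = (size (R1 ++ a :: R2) + size (inp t)).-1.
  by rewrite !size_cat ht.1 /=; lia.
rewrite e1 e2 e3; apply: cut_interchange_inp.
- by rewrite size_cat /=; lia.
- exact: cuttableI hs hr' p2.
- by apply: cuttableI ht hsr p3.
- exact: cuttableI ht hr p1.
- by rewrite -e3; apply: (cuttableI hs _ p4); rewrite -!catA; exact: htr.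
Qed.

(** The cuts needed below are of three kinds: precomposition with a cell [t]
with one output, and postcomposition with a cell [k] with one output, along
its last ([postR]) or its first ([postL]) input. *)
Lemma pre_cell t s a A G1 G2 D : is_cell2 t A [:: a] ->
  is_cell2 s (G1 ++ a :: G2) D ->
  is_cell2 (cut 0 (size G1) t s) (G1 ++ A ++ G2) D.
Proof.
move=> ht hs; rewrite -[D in is_cell2 (cut _ _ _ _) _ D]cats0.
exact: (cut_boundary (D1 := [::]) (D2 := [::]) ht hs (planar0 _ _)).
Qed.

Lemma postR_cell r k a b G K D : is_cell2 r G (a :: D) ->
  is_cell2 k (K ++ [:: a]) [:: b] ->
  is_cell2 (cut 0 (size K) r k) (K ++ G) (b :: D).
Proof.
move=> hr hk.
have := @cut_boundary X r k a G K [::] [:: b] [::] D hr hk.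
by rewrite cats0; apply; split; [right | left].
Qed.

Lemma postL_cell r k a b G K D : is_cell2 r G (D ++ [:: a]) ->
  is_cell2 k (a :: K) [:: b] ->
  is_cell2 (cut (size D) 0 r k) (G ++ K) (D ++ [:: b]).
Proof.
move=> hr hk.
have := @cut_boundary X r k a G [::] K [:: b] D [::] hr hk.
by apply; split; [left | right].
Qed.

Lemma pre_pre t s r a b A S1 S2 R1 R2 D :
  is_cell2 t A [:: a] -> is_cell2 s (S1 ++ a :: S2) [:: b] ->
  is_cell2 r (R1 ++ b :: R2) D ->
  cut 0 (size R1 + size S1) t (cut 0 (size R1) s r) =
  cut 0 (size R1) (cut 0 (size S1) t s) r.
Proof.
move=> ht hs hr.
exact: (@cut_assocE t s r a b A [::] [::] S1 S2 [::] [::] R1 R2 D).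
Qed.

Lemma pre_interchange t s r a b A B R1 R2 R3 D :
  is_cell2 t A [:: a] -> is_cell2 s B [:: b] ->
  is_cell2 r (R1 ++ a :: R2 ++ b :: R3) D ->
  cut 0 (size R1) t (cut 0 (size R1 + (size R2).+1) s r) =
  cut 0 (size R1 + size A + size R2) s (cut 0 (size R1) t r).
Proof.
move=> ht hs hr.
exact: (@cut_interchangeE t s r a b A B [::] [::] [::] [::] R1 R2 R3 D).
Qed.

Lemma pre_postR t r k a b d A G1 G2 D K :
  is_cell2 t A [:: a] -> is_cell2 r (G1 ++ a :: G2) (b :: D) ->
  is_cell2 k (K ++ [:: b]) [:: d] ->
  cut 0 (size K + size G1) t (cut 0 (size K) r k) =
  cut 0 (size K) (cut 0 (size G1) t r) k.
Proof.
move=> ht hr hk.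
apply: (@cut_assocE t r k a b A [::] [::] G1 G2 [::] D K [::] [:: d]) => //=.
all: by split; [right | left].
Qed.

Lemma pre_postR_side t r k b c d A G D K1 K2 :
  is_cell2 t A [:: c] -> is_cell2 r G (b :: D) ->
  is_cell2 k (K1 ++ c :: K2 ++ [:: b]) [:: d] ->
  cut 0 (size K1) t (cut 0 (size K1 + (size K2).+1) r k) =
  cut 0 (size K1 + size A + size K2) r (cut 0 (size K1) t k).
Proof.
move=> ht hr hk.
apply: (@cut_interchangeE t r k c b A G [::] [::] [::] D K1 K2 [::] [:: d]).
all: rewrite //=.
all: by split; [right | left].
Qed.

Lemma postR_postR r s k a b d G S K D :
  is_cell2 r G (a :: D) -> is_cell2 s (S ++ [:: a]) [:: b] ->
  is_cell2 k (K ++ [:: b]) [:: d] ->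
  cut 0 (size K + size S) r (cut 0 (size K) s k) =
  cut 0 (size K) (cut 0 (size S) r s) k.
Proof.
move=> hr hs hk.
apply: (@cut_assocE r s k a b G [::] D S [::] [::] [::] K [::] [:: d]) => //=.
all: by split; [right | left].
Qed.

Lemma pre_postL t r k a b d A G1 G2 D K :
  is_cell2 t A [:: a] -> is_cell2 r (G1 ++ a :: G2) (D ++ [:: b]) ->
  is_cell2 k (b :: K) [:: d] ->
  cut 0 (size G1) t (cut (size D) 0 r k) =
  cut (size D) 0 (cut 0 (size G1) t r) k.
Proof.
move=> ht hr hk.
apply: (@cut_assocE t r k a b A [::] [::] G1 G2 D [::] [::] K [:: d]) => //=.
all: by split; [left | right].
Qed.

Lemma pre_postL_side t r k b c d A G D K1 K2 :
  is_cell2 t A [:: c] -> is_cell2 r G (D ++ [:: b]) ->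
  is_cell2 k (b :: K1 ++ c :: K2) [:: d] ->
  cut (size D) 0 r (cut 0 (size K1).+1 t k) =
  cut 0 (size G + size K1) t (cut (size D) 0 r k).
Proof.
move=> ht hr hk.
apply: (@cut_interchangeE r t k b c G A D [::] [::] [::] [::] K1 K2 [:: d]).
all: rewrite //=.
all: by split; [left | right].
Qed.

Lemma postL_postL r s k a b d G S K D :
  is_cell2 r G (D ++ [:: a]) -> is_cell2 s (a :: S) [:: b] ->
  is_cell2 k (b :: K) [:: d] ->
  cut (size D) 0 r (cut 0 0 s k) = cut (size D) 0 (cut (size D) 0 r s) k.
Proof.
move=> hr hs hk; rewrite -{2}(addn0 (size D)).
apply: (@cut_assocE r s k a b G D [::] [::] S [::] [::] [::] K [:: d]) => //=.
all: by split; [left | right].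
Qed.

(** * Universal cells with one output *)

Lemma out_intro t A b : is_cell2 t A [:: b] ->
  (forall G1 G2 D s, is_cell2 s (G1 ++ A ++ G2) D ->
    exists2 r, is_cell2 r (G1 ++ b :: G2) D & s = cut 0 (size G1) t r) ->
  (forall G1 G2 D r1 r2, is_cell2 r1 (G1 ++ b :: G2) D ->
    is_cell2 r2 (G1 ++ b :: G2) D ->
    cut 0 (size G1) t r1 = cut 0 (size G1) t r2 -> r1 = r2) ->
  universal_out 0 t.
Proof.
move=> [hi ho] H1 H2; exists [::], b, [::]; split=> // G1 G2 D _ _ s.
rewrite /= cats0 hi => hs; have [r hr e] := H1 _ _ _ _ hs.
by exists r; split=> // r' [hr' e']; apply: (H2 _ _ _ _ _ hr hr'); rewrite -e.
Qed.

Lemma out_unique t A b G1 G2 D s : is_cell2 t A [:: b] -> universal_out 0 t ->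
  is_cell2 s (G1 ++ A ++ G2) D ->
  exists! r, is_cell2 r (G1 ++ b :: G2) D /\ s = cut 0 (size G1) t r.
Proof.
move=> [hi ho] [D1 [b' [D2 []]]]; rewrite ho; case: D1 => // -[<- <-] _ H hs.
apply: (H G1 G2 D) => //; first exact: cell2_outp_neq0 hs.
by rewrite hi /= cats0.
Qed.

(** The universal properties are used in two halves, existence of a
factorization ([factor]) and cancellation ([inj]). The cells that occur have
one output, and two inputs when universality at an input is at stake: [inpR]
refers to the second of two inputs and [inpL] to the first. *)
Lemma out_factor t A b G1 G2 D s : is_cell2 t A [:: b] -> universal_out 0 t ->
  is_cell2 s (G1 ++ A ++ G2) D ->
  exists2 r, is_cell2 r (G1 ++ b :: G2) D & s = cut 0 (size G1) t r.
Proof. by move=> ht ut /(out_unique ht ut)[r [[hr e] _]]; exists r. Qed.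

Lemma out_inj t A b G1 G2 D r1 r2 : is_cell2 t A [:: b] -> universal_out 0 t ->
  is_cell2 r1 (G1 ++ b :: G2) D -> is_cell2 r2 (G1 ++ b :: G2) D ->
  cut 0 (size G1) t r1 = cut 0 (size G1) t r2 -> r1 = r2.
Proof.
move=> ht ut h1 h2 eq; have [r [_ H]] := out_unique ht ut (pre_cell ht h1).
by rewrite -(H r1) // -(H r2).
Qed.

Lemma inpR_intro t c a b : is_cell2 t [:: c; a] [:: b] ->
  (forall G D s, G <> [::] -> is_cell2 s (c :: G) (b :: D) ->
    exists2 r, is_cell2 r G (a :: D) & s = cut 0 1 r t) ->
  (forall G D r1 r2, is_cell2 r1 G (a :: D) -> is_cell2 r2 G (a :: D) ->
    cut 0 1 r1 t = cut 0 1 r2 t -> r1 = r2) ->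
  universal_inp 1 t.
Proof.
move=> [hi ho] H1 H2; exists [:: c], a, [::]; split=> //.
move=> D1 D2 G G0 [[//|->] _] s; rewrite ho /= cats0 => hs.
have [r hr e] := H1 _ _ _ G0 hs; exists r; split=> // r' [hr' e'].
by apply: H2 hr hr' _; rewrite -e.
Qed.

Lemma inpR_unique t c a b G D s : is_cell2 t [:: c; a] [:: b] ->
  universal_inp 1 t -> G <> [::] -> is_cell2 s (c :: G) (b :: D) ->
  exists! r, is_cell2 r G (a :: D) /\ s = cut 0 1 r t.
Proof.
move=> [hi ho] [G1 [a' [G2 []]]]; rewrite hi; case: G1 => [//|c' [|//]].
move=> [<- <- <-] _ H G0 hs; apply: (H [::] D) => //.
  by split; [right | left].
by rewrite ho cats0.
Qed.

Lemma inpR_factor t c a b G D s : is_cell2 t [:: c; a] [:: b] ->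
  universal_inp 1 t -> G <> [::] -> is_cell2 s (c :: G) (b :: D) ->
  exists2 r, is_cell2 r G (a :: D) & s = cut 0 1 r t.
Proof. by move=> ht ut G0 /(inpR_unique ht ut G0)[r [[hr e] _]]; exists r. Qed.

Lemma inpR_inj t c a b G D r1 r2 : is_cell2 t [:: c; a] [:: b] ->
  universal_inp 1 t -> is_cell2 r1 G (a :: D) -> is_cell2 r2 G (a :: D) ->
  cut 0 1 r1 t = cut 0 1 r2 t -> r1 = r2.
Proof.
move=> ht ut h1 h2 eq; have G0 := cell2_inp_neq0 h1.
have [r [_ H]] := inpR_unique ht ut G0 (postR_cell (K := [:: c]) h1 ht).
by rewrite -(H r1) // -(H r2).
Qed.

Lemma inpL_intro t a c b : is_cell2 t [:: a; c] [:: b] ->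
  (forall G D s, G <> [::] -> is_cell2 s (G ++ [:: c]) (D ++ [:: b]) ->
    exists2 r, is_cell2 r G (D ++ [:: a]) & s = cut (size D) 0 r t) ->
  (forall G D r1 r2,
    is_cell2 r1 G (D ++ [:: a]) -> is_cell2 r2 G (D ++ [:: a]) ->
    cut (size D) 0 r1 t = cut (size D) 0 r2 t -> r1 = r2) ->
  universal_inp 0 t.
Proof.
move=> [hi ho] H1 H2; exists [::], a, [:: c]; split=> //.
move=> D1 D2 G G0 [_ [//|->]] s; rewrite ho /= => hs.
have [r hr e] := H1 _ _ _ G0 hs; exists r; split=> // r' [hr' e'].
by apply: H2 hr hr' _; rewrite -e.
Qed.

Lemma inpL_unique t a c b G D s : is_cell2 t [:: a; c] [:: b] ->
  universal_inp 0 t -> G <> [::] -> is_cell2 s (G ++ [:: c]) (D ++ [:: b]) ->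
  exists! r, is_cell2 r G (D ++ [:: a]) /\ s = cut (size D) 0 r t.
Proof.
move=> [hi ho] [G1 [a' [G2 []]]]; rewrite hi; case: G1 => [|//].
move=> [<- <-] _ H G0 hs; apply: (H D [::]) => //.
  by split; [left | right].
by rewrite ho.
Qed.

Lemma inpL_factor t a c b G D s : is_cell2 t [:: a; c] [:: b] ->
  universal_inp 0 t -> G <> [::] -> is_cell2 s (G ++ [:: c]) (D ++ [:: b]) ->
  exists2 r, is_cell2 r G (D ++ [:: a]) & s = cut (size D) 0 r t.
Proof. by move=> ht ut G0 /(inpL_unique ht ut G0)[r [[hr e] _]]; exists r. Qed.

Lemma inpL_inj t a c b G D r1 r2 : is_cell2 t [:: a; c] [:: b] ->
  universal_inp 0 t ->
  is_cell2 r1 G (D ++ [:: a]) -> is_cell2 r2 G (D ++ [:: a]) ->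
  cut (size D) 0 r1 t = cut (size D) 0 r2 t -> r1 = r2.
Proof.
move=> ht ut h1 h2 eq; have G0 := cell2_inp_neq0 h1.
have [r [_ H]] := inpL_unique ht ut G0 (postL_cell h1 ht).
by rewrite -(H r1) // -(H r2).
Qed.

Lemma universal_out_cut t s a b A S1 S2 :
  is_cell2 t A [:: a] -> is_cell2 s (S1 ++ a :: S2) [:: b] ->
  universal_out 0 t -> universal_out 0 s ->
  universal_out 0 (cut 0 (size S1) t s).
Proof.
move=> ht hs ut us.
apply: (out_intro (pre_cell ht hs)) => G1 G2 D.
  move=> q hq.
  have hq' : is_cell2 q ((G1 ++ S1) ++ A ++ S2 ++ G2) D.
    by move: hq; rewrite -!catA.
  have [w hw ->] := out_factor ht ut hq'.
  have hw' : is_cell2 w (G1 ++ (S1 ++ a :: S2) ++ G2) D.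
    by move: hw; rewrite -!catA.
  have [r hr ->] := out_factor hs us hw'.
  by exists r; rewrite // size_cat (pre_pre ht hs hr).
move=> r1 r2 hr1 hr2.
rewrite -(pre_pre ht hs hr1) -(pre_pre ht hs hr2) -size_cat => eq.
apply: (out_inj hs us hr1 hr2).
apply: (out_inj (G2 := S2 ++ G2) (D := D) ht ut _ _ eq).
  by have := pre_cell hs hr1; rewrite -!catA.
by have := pre_cell hs hr2; rewrite -!catA.
Qed.

(** Precomposition with [t] identifies the cells to be factored through [s]
with cells that factor uniquely through the composite. *)
Lemma universal_out_cancel t s a b A S1 S2 :
  is_cell2 t A [:: a] -> is_cell2 s (S1 ++ a :: S2) [:: b] ->
  universal_out 0 t -> universal_out 0 (cut 0 (size S1) t s) ->
  universal_out 0 s.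
Proof.
move=> ht hs ut uts; have hts := pre_cell ht hs.
apply: (out_intro hs) => G1 G2 D.
  move=> q hq.
  have hq' : is_cell2 q ((G1 ++ S1) ++ a :: S2 ++ G2) D.
    by move: hq; rewrite -!catA.
  have htq := pre_cell ht hq'.
  have htq' : is_cell2 (cut 0 (size (G1 ++ S1)) t q)
      (G1 ++ (S1 ++ A ++ S2) ++ G2) D by move: htq; rewrite -!catA.
  have [r hr e] := out_factor hts uts htq'.
  exists r => //; apply: (out_inj ht ut hq').
    by have := pre_cell hs hr; rewrite -!catA.
  by rewrite e size_cat (pre_pre ht hs hr).
move=> r1 r2 hr1 hr2 eq; apply: (out_inj hts uts hr1 hr2).
by rewrite -(pre_pre ht hs hr1) -(pre_pre ht hs hr2) eq.
Qed.

(** * Tensor units from absorption *)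

(** Writing [a] as [e * c], the cell [l] is [p] tensored with [c].
Universality of [l] at the second input rests on naturality: on a cell whose
inputs begin with [e], absorbing [u] at the output by [l] is the same as
absorbing it at the input by [p] ([nat]). Every sequence of inputs starting at
the source of [e] can be brought to this form by writing its first 1-cell as
[e * c1]. *)
Lemma left_unitor_of_absorbed e u p a : tensor_left_universal e ->
  is_cell2 p [:: u; e] [:: e] -> universal_out 0 p -> src a = src e ->
  exists l, [/\ is_cell2 l [:: u; a] [:: a], universal_out 0 l &
                universal_inp 1 l].
Proof.
move=> [eL _] hp up sa.
have tu : tgt u = src e := inp_adjacent (G1 := [::]) hp.
have [c [h [_ hh uh uh']]] := eL _ _ (conj sa erefl).
have hph := pre_cell (G1 := [::]) hp hh.
have [l hl el] := out_factor (G1 := [:: u]) (G2 := [::]) hh uh hph.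
have ul : universal_out 0 l.
  apply: (universal_out_cancel (S1 := [:: u]) hh hl uh); rewrite -el.
  exact: (universal_out_cut (S1 := [::]) hp hh).
have nat M D r : M <> [::] -> is_cell2 r (e :: M) (a :: D) ->
    cut 0 1 r l = cut 0 0 p r.
  move=> M0 hr; have [w hw ->] := inpR_factor hh uh' M0 hr.
  rewrite (pre_postR_side (K1 := [::]) (K2 := [::]) hp hw hh) el.
  by rewrite -(postR_postR (S := [:: e]) (K := [:: u]) hw hh hl).
exists l; split=> //; apply: (inpR_intro hl).
  case=> [//|g G] D s _ hs.
  have sg : src g = src e by rewrite -tu (inp_adjacent (G1 := [::]) hs).
  have [c1 [h1 [_ hh1 uh1 _]]] := eL _ _ (conj sg erefl).
  have hs1 := pre_cell (G1 := [:: u]) hh1 hs.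
  have [w hw e1] := out_factor (G1 := [::]) hp up hs1.
  have [r hr e2] := out_factor (G1 := [::]) hh1 uh1 hw.
  exists r => //; apply: (out_inj (G1 := [:: u]) hh1 uh1 hs).
    exact: (postR_cell (K := [:: u]) hr hl).
  rewrite e1 (pre_postR (G1 := [::]) (K := [:: u]) hh1 hr hl).
  by rewrite -[size [::]]/0 -e2 (nat (c1 :: G) D w).
case=> [|g G] D r1 r2 hr1 hr2 eq; first by case: (cell2_inp_neq0 hr1).
have sg : src g = src e by rewrite (src_boundary hr1).
have [c1 [h1 [_ hh1 uh1 _]]] := eL _ _ (conj sg erefl).
apply: (out_inj (G1 := [::]) hh1 uh1 hr1 hr2).
have hw1 := pre_cell (G1 := [::]) hh1 hr1.
have hw2 := pre_cell (G1 := [::]) hh1 hr2.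
apply: (out_inj (G1 := [::]) hp up hw1 hw2).
rewrite -(nat _ _ _ _ hw1) // -(nat _ _ _ _ hw2) //.
rewrite -(pre_postR (G1 := [::]) (K := [:: u]) hh1 hr1 hl).
by rewrite -(pre_postR (G1 := [::]) (K := [:: u]) hh1 hr2 hl) eq.
Qed.

(** Two ways to make [e] appear just after [A]. If a 1-cell [g] follows [A],
write [g] as [e * c]. If [A] comes last, tensor the last output [d] with [e]
on the right: as [(d, e) -> (v)] is universal at its first input, nothing is
lost. *)
Lemma universal_out_test e t A b : tensor_universal e ->
  is_cell2 t A [:: b] -> tgt b = src e ->
  (forall G1 M D s, is_cell2 s (G1 ++ A ++ e :: M) D ->
    exists2 r, is_cell2 r (G1 ++ b :: e :: M) D & s = cut 0 (size G1) t r) ->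
  (forall G1 M D r1 r2, is_cell2 r1 (G1 ++ b :: e :: M) D ->
    is_cell2 r2 (G1 ++ b :: e :: M) D ->
    cut 0 (size G1) t r1 = cut 0 (size G1) t r2 -> r1 = r2) ->
  universal_out 0 t.
Proof.
move=> [[eL _] [_ eR]] ht tb fac inj.
have swap h c g G1 G2 D r : is_cell2 h [:: e; c] [:: g] ->
    is_cell2 r (G1 ++ b :: g :: G2) D ->
    cut 0 (size G1) t (cut 0 (size (G1 ++ [:: b])) h r) =
    cut 0 (size (G1 ++ A)) h (cut 0 (size G1) t r).
  move=> hh hr; rewrite !size_cat (pre_interchange (R2 := [::]) ht hh hr).
  by rewrite addn0.
have post k d v G1 D r : is_cell2 k [:: d; e] [:: v] ->
    is_cell2 r (G1 ++ [:: b]) (D ++ [:: d]) ->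
    cut 0 (size G1) t (cut (size D) 0 r k) =
    cut (size D) 0 (cut 0 (size G1) t r) k.
  by move=> hk hr; apply: pre_postL ht hr hk.
apply: (out_intro ht) => G1 [|g G] D.
- case/lastP: D => [|D d]; first by move=> s /cell2_outp_neq0.
  rewrite cats0 -cats1 => s hs.
  have td : tgt d = src e by rewrite -tb (composite_outp_tgt ht hs).
  have [v [k [_ hk _ uk]]] := eR _ _ (conj erefl td).
  have hsk := postL_cell hs hk; rewrite -catA in hsk.
  have [w hw ew] := fac _ _ _ _ hsk.
  have G1b : G1 ++ [:: b] <> [::] by case: (G1).
  rewrite -cat_rcons -cats1 in hw.
  have [r hr er] := inpL_factor hk uk G1b hw.
  exists r => //; have htr := pre_cell ht hr; rewrite cats0 in htr.
  by apply: (inpL_inj hk uk hs htr); rewrite -(post k d v) // -er.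
- move=> s hs; have sg : src g = src e by rewrite -tb (composite_inp_src ht hs).
  have [c [h [_ hh uh _]]] := eL _ _ (conj sg erefl).
  rewrite catA in hs; have hhs := pre_cell hh hs; rewrite -catA in hhs.
  have [w hw ew] := fac _ _ _ _ hhs.
  rewrite -cat_rcons -cats1 in hw.
  have [r hr er] := out_factor hh uh hw; rewrite -catA /= in hr.
  exists r => //; have htr := pre_cell ht hr; rewrite catA in htr.
  by apply: (out_inj hh uh hs htr); rewrite -(swap h c g G1 G D) // -er.
- case/lastP: D => [|D d]; first by move=> r1 r2 /cell2_outp_neq0.
  rewrite -cats1 => r1 r2 hr1 hr2 eq.
  have td : tgt d = src e by rewrite -tb (tgt_boundary hr1).
  have [v [k [_ hk _ uk]]] := eR _ _ (conj erefl td).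
  apply: (inpL_inj hk uk hr1 hr2); apply: (inj G1 [::] (D ++ [:: v])).
  + by have := postL_cell hr1 hk; rewrite -catA.
  + by have := postL_cell hr2 hk; rewrite -catA.
  + by rewrite (post k d v) // (post k d v) // eq.
- move=> r1 r2 hr1 hr2 eq.
  have sg : src g = src e by rewrite -tb (inp_adjacent hr1).
  have [c [h [_ hh uh _]]] := eL _ _ (conj sg erefl).
  have hr1' : is_cell2 r1 ((G1 ++ [:: b]) ++ g :: G) D by rewrite -catA.
  have hr2' : is_cell2 r2 ((G1 ++ [:: b]) ++ g :: G) D by rewrite -catA.
  apply: (out_inj hh uh hr1' hr2'); apply: (inj G1 (c :: G) D).
  + by have := pre_cell hh hr1'; rewrite -catA.
  + by have := pre_cell hh hr2'; rewrite -catA.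
  + by rewrite (swap h c g G1 G D) // (swap h c g G1 G D) // eq.
Qed.

(** The tensor [k : (b, e) -> (v)] can be cancelled, so absorbing [u] into [e]
in [(b, u, e)] induces an absorption [l] of [u] into [b]. Next to an [e],
using [l] or [p] makes no difference ([nat]), so the properties of [p] pass to
[l]. *)
Lemma right_unitor_of_absorbed e u p b : tensor_universal e ->
  is_cell2 p [:: u; e] [:: e] -> universal_out 0 p -> tgt b = src e ->
  exists r, [/\ is_cell2 r [:: b; u] [:: b], universal_out 0 r &
                universal_inp 0 r].
Proof.
move=> eU hp up tb; have [_ [_ eR]] := eU.
have [v [k [_ hk uk uk']]] := eR _ _ (conj erefl tb).
have hpk := pre_cell (G1 := [:: b]) hp hk.
have bu0 : [:: b; u] <> [::] by [].
have [l hl el] := inpL_factor (D := [::]) hk uk' bu0 hpk.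
have nat G1 M D w : is_cell2 w (G1 ++ b :: e :: M) D ->
    cut 0 (size G1) l w = cut 0 (size G1).+1 p w.
  move=> hw; have [w' hw' ->] := out_factor (G1 := G1) hk uk hw.
  rewrite -addn1 (pre_pre (S1 := [:: b]) hp hk hw') el.
  by rewrite -(pre_pre (S1 := [::]) hl hk hw') addn0.
exists l; split=> //.
  apply: (universal_out_test eU hl) => // G1 M D.
    move=> s hs; have hs' : is_cell2 s ((G1 ++ [:: b]) ++ [:: u; e] ++ M) D.
      by rewrite -catA.
    have [r hr er] := out_factor hp up hs'; rewrite -catA in hr.
    by exists r; rewrite // (nat _ _ _ _ hr) er size_cat addn1.
  move=> r1 r2 hr1 hr2; rewrite (nat _ _ _ _ hr1) (nat _ _ _ _ hr2) => eq.
  rewrite -cat_rcons in hr1 hr2.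
  by apply: (out_inj hp up hr1 hr2); rewrite size_rcons.
have exch G D r : is_cell2 r G (D ++ [:: b]) ->
    cut (size D) 0 (cut (size D) 0 r l) k =
    cut 0 (size G) p (cut (size D) 0 r k).
  move=> hr; rewrite -(postL_postL hr hl hk) -el.
  by rewrite (pre_postL_side (K1 := [::]) hp hr hk) addn0.
apply: (inpL_intro hl) => G D.
  move=> s G0 hs; have hsk := postL_cell hs hk; rewrite -catA in hsk.
  have [w hw ew] := out_factor (G2 := [::]) hp up hsk.
  have [r hr er] := inpL_factor hk uk' G0 hw.
  exists r => //; apply: (inpL_inj hk uk' hs (postL_cell hr hl)).
  by rewrite (exch G) // -er.
move=> r1 r2 hr1 hr2 eq; apply: (inpL_inj hk uk' hr1 hr2).
apply: (out_inj (G2 := [::]) hp up (postL_cell hr1 hk) (postL_cell hr2 hk)).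
by rewrite -!(exch G) // eq.
Qed.

Lemma tensor_unit_of_absorbed e u p : tensor_universal e ->
  is_cell2 p [:: u; e] [:: e] -> universal_out 0 p -> tensor_unit (src e) u.
Proof.
move=> eU hp up; split.
- split; first exact: src_boundary hp.
  exact: (inp_adjacent (G1 := [::]) hp).
- by move=> y a [sa _]; apply: (left_unitor_of_absorbed (proj1 eU) hp up sa).
- by move=> z b [_ tb]; apply: (right_unitor_of_absorbed eU hp up tb).
Qed.

(** * Universality from a tensor inverse *)

(** As usual for a split monomorphism that is also epi: the factorization of
the unit through [f] is a one-sided inverse, and cancelling [f] shows that it
is two-sided. *)
Lemma universal_out_invertible a f : unital X ->
  is_cell2 f [:: a] [:: a] -> universal_out 0 f ->
  exists2 g, is_cell2 g [:: a] [:: a] &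
    (forall G D s, is_cell2 s G (a :: D) -> cut 0 0 (cut 0 0 s g) f = s) /\
    (forall G D s, is_cell2 s G (a :: D) -> cut 0 0 (cut 0 0 s f) g = s).
Proof.
move=> un hf uf; have [i [hi iR iL]] := un a.
have [g hg eg] := out_factor (G1 := [::]) (G2 := [::]) hf uf hi.
have hgf := pre_cell (G1 := [::]) (G2 := [::]) hg hf.
have eg' : cut 0 0 g f = i.
  apply: (out_inj (G1 := [::]) (G2 := [::]) hf uf hgf hi).
  rewrite -[size _]/(0 + 0) (pre_pre (S1 := [::]) (R1 := [::]) hf hg hf) -eg.
  rewrite iL ?iR //.
    exact: (@cuttableI f i a [:: a] [:: a] [::] [::] [::] [::]).
  exact: (@cuttableI i f a [:: a] [:: a] [::] [::] [::] [::]).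
have idR G D s : is_cell2 s G (a :: D) -> cut 0 0 s i = s.
  move=> hs; apply: iR.
  by apply: (@cuttableI s i a G [:: a] [::] [::] [::] D) => //; split; left.
exists g => //; split=> G D s hs.
  rewrite -(postR_postR (S := [::]) (K := [::]) hs hg hf) eg'.
  exact: idR hs.
rewrite -(postR_postR (S := [::]) (K := [::]) hs hf hg) -[cut 0 (size _) f g]eg.
exact: idR hs.
Qed.

(** The chosen unitor [l0] and [l] have the same inputs and are both universal
at their outputs, so they differ by an invertible cell, and [l0] is universal
at its second input. *)
Lemma unit_universal_inp x u a l : unital X -> tensor_unit x u -> src a = x ->
  is_cell2 l [:: u; a] [:: a] -> universal_out 0 l -> universal_inp 1 l.
Proof.
move=> un [_ unitL _] sa hl ul.
have [l0 [hl0 ul0 ul0']] := unitL _ _ (conj sa erefl).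
have [f hf ef] := out_factor (G1 := [::]) (G2 := [::]) hl0 ul0 hl.
have uf : universal_out 0 f.
  by apply: (universal_out_cancel (S1 := [::]) hl0 hf ul0); rewrite -ef.
have [g hg [gf fg]] := universal_out_invertible un hf uf.
have cutl G D r : is_cell2 r G (a :: D) ->
    cut 0 1 r l = cut 0 0 (cut 0 1 r l0) f.
  by move=> hr; rewrite ef (postR_postR (S := [:: u]) (K := [::]) hr hl0 hf).
apply: (inpR_intro hl) => G D.
  move=> s G0 hs.
  have [r hr er] := inpR_factor hl0 ul0' G0 (postR_cell (K := [::]) hs hg).
  by exists r; rewrite // (cutl _ _ _ hr) -er (gf _ _ _ hs).
move=> r1 r2 hr1 hr2; rewrite (cutl _ _ _ hr1) (cutl _ _ _ hr2) => eq.
apply: (inpR_inj hl0 ul0' hr1 hr2).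
have h1 := postR_cell (K := [:: u]) hr1 hl0.
have h2 := postR_cell (K := [:: u]) hr2 hl0.
by rewrite -[LHS](fg _ _ _ h1) -[RHS](fg _ _ _ h2) eq.
Qed.

(** Composing with [h] and then [t] amounts to composing with [k] and
precomposing with [p], two bijective operations. *)
Lemma inverse_composite_factor x ux c d a b p h t :
  unital X -> tensor_unit x ux -> src a = x ->
  is_cell2 p [:: c; d] [:: ux] -> universal_out 0 p ->
  is_cell2 h [:: d; a] [:: b] -> universal_out 0 h ->
  is_cell2 t [:: c; b] [:: a] -> universal_out 0 t ->
  exists2 k, is_cell2 k [:: ux; a] [:: a] /\ universal_inp 1 k &
  forall G D r, is_cell2 r G (a :: D) ->
    cut 0 1 (cut 0 1 r h) t = cut 0 0 p (cut 0 1 r k).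
Proof.
move=> un uxU sa hp up hh uh ht ut.
have hht := pre_cell (G1 := [:: c]) hh ht.
have [k hk ek] := out_factor (G1 := [::]) hp up hht.
exists k; first split=> //.
  apply: (unit_universal_inp un uxU sa hk).
  apply: (universal_out_cancel (S1 := [::]) hp hk up); rewrite -ek.
  exact: (universal_out_cut (S1 := [:: c]) hh ht).
move=> G D r hr; rewrite -(postR_postR (S := [:: d]) (K := [:: c]) hr hh ht) ek.
by rewrite (pre_postR_side (K1 := [::]) (K2 := [::]) hp hr hk).
Qed.

(** Composing with [h] is injective, as composing further with [t] is; it
reaches every [s] because the composite of [s] with [t] is that of some [r]
with [h] and then [t], and composing with [t] is injective by the same
argument with the roles of [h] and [t] exchanged. *)
Lemma inverse_cell_universal_inp x y ux uy e e' a b p q h t :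
  unital X -> tensor_unit x ux -> tensor_unit y uy ->
  is_cell2 p [:: e; e'] [:: ux] -> universal_out 0 p ->
  is_cell2 q [:: e'; e] [:: uy] -> universal_out 0 q ->
  src a = x -> src b = y ->
  is_cell2 h [:: e; b] [:: a] -> universal_out 0 h ->
  is_cell2 t [:: e'; a] [:: b] -> universal_out 0 t ->
  universal_inp 1 h.
Proof.
move=> un uxU uyU hp up hq uq sa sb hh uh ht ut.
have [k [hk uk] ek] := inverse_composite_factor un uyU sb hq uq hh uh ht ut.
have [k' [hk' uk'] ek'] := inverse_composite_factor un uxU sa hp up ht ut hh uh.
have tinj G D r1 r2 : is_cell2 r1 G (a :: D) -> is_cell2 r2 G (a :: D) ->
    cut 0 1 r1 t = cut 0 1 r2 t -> r1 = r2.
  move=> hr1 hr2 eq; apply: (inpR_inj hk' uk' hr1 hr2).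
  apply: (out_inj (G1 := [::]) hp up (postR_cell (K := [:: ux]) hr1 hk')
                                     (postR_cell (K := [:: ux]) hr2 hk')).
  by rewrite -(ek' _ _ _ hr1) -(ek' _ _ _ hr2) eq.
apply: (inpR_intro hh) => G D.
  move=> s G0 hs; have hst := postR_cell (K := [:: e']) hs ht.
  have [w hw ew] := out_factor (G1 := [::]) hq uq hst.
  have [r hr er] := inpR_factor hk uk G0 hw.
  exists r => //; apply: (tinj _ _ _ _ hs (postR_cell (K := [:: e]) hr hh)).
  by rewrite (ek _ _ _ hr) -er.
move=> r1 r2 hr1 hr2 eq; apply: (inpR_inj hk uk hr1 hr2).
apply: (out_inj (G1 := [::]) hq uq (postR_cell (K := [:: uy]) hr1 hk)
                                   (postR_cell (K := [:: uy]) hr2 hk)).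
by rewrite -(ek _ _ _ hr1) -(ek _ _ _ hr2) eq.
Qed.

(** Contract [(c, d)] in [(c, d, a)] and absorb the unit; the result factors
through the tensor [t] of [d] and [a]. *)
Lemma inverse_cell_exists w u c d a b p t : tensor_unit w u -> src a = w ->
  is_cell2 p [:: c; d] [:: u] -> universal_out 0 p ->
  is_cell2 t [:: d; a] [:: b] -> universal_out 0 t ->
  exists2 h, is_cell2 h [:: c; b] [:: a] & universal_out 0 h.
Proof.
move=> [_ unitL _] sa hp up ht ut.
have [l [hl ul _]] := unitL _ _ (conj sa erefl).
have hpl := pre_cell (G1 := [::]) hp hl.
have [h hh eh] := out_factor (G1 := [:: c]) (G2 := [::]) ht ut hpl.
exists h => //; apply: (universal_out_cancel (S1 := [:: c]) ht hh ut).
by rewrite -eh; apply: (universal_out_cut (S1 := [::]) hp hl).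
Qed.

(** Both clauses use the same pair of inverse cells, one of which is a given
tensor and the other obtained from it by contraction; the clauses differ in
which of the two is wanted. *)
Lemma left_universal_of_inverse x y ux uy e e' p q :
  tensor_representable1 X -> tensor_unit x ux -> tensor_unit y uy ->
  is_cell1 e x y -> is_cell1 e' y x ->
  is_cell2 p [:: e; e'] [:: ux] -> universal_out 0 p ->
  is_cell2 q [:: e'; e] [:: uy] -> universal_out 0 q ->
  tensor_left_universal e.
Proof.
move=> [un tens] uxU uyU he he' hp up hq uq; have [se te] := he.
rewrite /tensor_left_universal se te.
split=> z a ha.
  have [b [t [hb ht ut]]] := tens _ _ _ _ _ he' ha.
  have [h hh uh] := inverse_cell_exists uxU ha.1 hp up ht ut.
  exists b, h; split=> //.
  by apply: (inverse_cell_universal_inp un uxU uyU hp up hq uq _ _ hh uh ht ut);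
    [case: ha | case: hb].
have [b [t [hb ht ut]]] := tens _ _ _ _ _ he ha.
have [h hh uh] := inverse_cell_exists uyU ha.1 hq uq ht ut.
exists b, t; split=> //.
by apply: (inverse_cell_universal_inp un uxU uyU hp up hq uq _ _ ht ut hh uh);
  [case: hb | case: ha].
Qed.

(** * A tensor inverse from universality *)

(** The cell [t] satisfies, next to [e], an equation which says that
precomposing with [p] and [t] is precomposing with the universal cell [(e, e',
e) -> (e)]; since precomposing with [p] is bijective, so is precomposing with
[t], in contexts with [e] on the right. *)
Lemma inverse_of_universal e u u' p p' : tensor_universal e ->
  tensor_unit (tgt e) u' ->
  is_cell2 p [:: u; e] [:: e] -> universal_out 0 p -> universal_inp 0 p ->
  is_cell2 p' [:: e; u'] [:: e] -> universal_out 0 p' ->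
  exists e' t q, [/\ is_cell1 e' (tgt e) (src e),
    is_cell2 t [:: e; e'] [:: u] /\ universal_out 0 t &
    is_cell2 q [:: e'; e] [:: u'] /\ universal_out 0 q].
Proof.
move=> eU [hu' _ _] hp up up' hp' uop'; have [_ [eR _]] := eU.
have [e' [q [he' hq uq _]]] := eR _ _ hu'.
have hm := pre_cell (G1 := [:: e]) (G2 := [::]) hq hp'.
have um : universal_out 0 (cut 0 1 q p').
  exact: (universal_out_cut (S1 := [:: e]) hq hp').
have ee0 : [:: e; e'] <> [::] by [].
have [t ht et] := inpL_factor (D := [::]) hp up' ee0 hm.
rewrite -[size _]/1 -[size _]/0 in et.
have comp G1 M D w : is_cell2 w (G1 ++ e :: M) D ->
    cut 0 (size G1) t (cut 0 (size G1) p w) = cut 0 (size G1) (cut 0 1 q p') w.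
  by move=> hw; rewrite et -(pre_pre (S1 := [::]) ht hp hw) addn0.
exists e', t, q; split=> //; split=> //.
apply: (universal_out_test eU ht).
- by rewrite (inp_adjacent (G1 := [::]) hp).
- move=> G1 M D s hs; have [w hw ->] := out_factor (G2 := M) hm um hs.
  exists (cut 0 (size G1) p w); first exact: pre_cell hp hw.
  by rewrite (comp _ _ _ _ hw).
move=> G1 M D r1 r2 hr1 hr2.
have [w1 hw1 ->] := out_factor (G2 := M) hp up hr1.
have [w2 hw2 ->] := out_factor (G2 := M) hp up hr2.
rewrite (comp _ _ _ _ hw1) (comp _ _ _ _ hw2) => eq.
by rewrite (out_inj hm um hw1 hw2 eq).
Qed.

End Cuts.

(** * Left-right symmetry *)

Section Mirror.
Variable X : polybicategory.
Implicit Types (t s r p : cell2 X) (G D : seq (cell1 X)).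

Fact mirror_inp_neq0 p : rev (inp p) <> [::].
Proof. by move/(congr1 rev); rewrite revK; apply: inp_neq0. Qed.

Fact mirror_outp_neq0 p : rev (outp p) <> [::].
Proof. by move/(congr1 rev); rewrite revK; apply: outp_neq0. Qed.

Fact mirror_boundaryP p : exists x y,
  composable (@tgt X) (@src X) x (rev (inp p)) y /\
  composable (@tgt X) (@src X) x (rev (outp p)) y.
Proof.
have [x [y [hi ho]]] := boundaryP p.
by exists y, x; split; apply: (composable_rev _ _ _ _ _).1.
Qed.

Definition mirror_polygraph : polygraph :=
  @Polygraph (cell0 X) (cell1 X) (cell2 X) (@tgt X) (@src X)
    (fun p => rev (inp p)) (fun p => rev (outp p))
    mirror_inp_neq0 mirror_outp_neq0 mirror_boundaryP.

(** Positions are counted from the other end of the sequences. The arguments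
keep their order, since inputs remain inputs and outputs remain outputs. *)
Definition mirror_cut j i t s : cell2 X :=
  cut (size (outp t) - j.+1) (size (inp s) - i.+1) t s.

Lemma mirror_cell2 p G D :
  is_cell2 (P := mirror_polygraph) p G D <-> is_cell2 p (rev G) (rev D).
Proof.
by split=> -[/=]; [move=> <- <- | move=> hi ho];
  split; rewrite /= ?hi ?ho ?revK.
Qed.

Lemma planar_rev (T : Type) (G1 G2 D1 D2 : seq T) :
  planar G1 G2 D1 D2 -> planar (rev G2) (rev G1) (rev D2) (rev D1).
Proof.
by case=> h1 h2; split; [case: h2 | case: h1] => ->; [left|right|left|right].
Qed.

Lemma mirror_cuttable j i t s : cuttable (P := mirror_polygraph) j i t s ->
  [/\ cuttable (size (outp t) - j.+1) (size (inp s) - i.+1) t s,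
      j < size (outp t) & i < size (inp s)].
Proof.
case=> a [G1 [G2 [D1 [D2 [ho hi <- <- pl]]]]].
have := congr1 rev hi; have := congr1 rev ho.
rewrite !revK !rev_cat !rev_cons !cat_rcons => {}ho {}hi.
have eo := congr1 size ho; have ei := congr1 size hi.
rewrite !size_cat /= !size_rev in eo ei.
rewrite eo ei; split; rewrite ?addnS ?ltnS ?leq_addl //.
exists a, (rev G2), (rev G1), (rev D2), (rev D1).
by rewrite !size_rev -!addnS !addnK; split=> //; apply: planar_rev.
Qed.

Lemma size_cut j i t s : cuttable j i t s ->
  size (inp (cut j i t s)) = (size (inp s)).-1 + size (inp t) /\
  size (outp (cut j i t s)) = (size (outp t)).-1 + size (outp s).
Proof.
case=> a [G1 [G2 [D1 [D2 [ho hi <- <- pl]]]]].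
have [-> ->] := cut_boundary (conj erefl ho) (conj hi erefl) pl.
by rewrite ho hi !size_cat /=; split; lia.
Qed.

Fact mirror_cut_boundary t s a G G1 G2 D D1 D2 :
  is_cell2 (P := mirror_polygraph) t G (D1 ++ a :: D2) ->
  is_cell2 (P := mirror_polygraph) s (G1 ++ a :: G2) D ->
  planar G1 G2 D1 D2 ->
  is_cell2 (P := mirror_polygraph) (mirror_cut (size D1) (size G1) t s)
    (G1 ++ G ++ G2) (D1 ++ D ++ D2).
Proof.
move=> /mirror_cell2 + /mirror_cell2 + /planar_rev pl.
rewrite !rev_cat !rev_cons !cat_rcons => ht hs; apply/mirror_cell2.
have := cut_boundary ht hs pl; rewrite /mirror_cut ht.2 hs.1 !rev_cat -!catA.
by congr (is_cell2 (cut _ _ _ _) _ _); rewrite !size_cat /= !size_rev; lia.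
Qed.

Fact mirror_cut_assoc j i l k t s r :
  cuttable (P := mirror_polygraph) l k s r ->
  cuttable (P := mirror_polygraph) j (k + i) t (mirror_cut l k s r) ->
  cuttable (P := mirror_polygraph) j i t s ->
  cuttable (P := mirror_polygraph) (j + l) k (mirror_cut j i t s) r ->
  mirror_cut j (k + i) t (mirror_cut l k s r) =
  mirror_cut (j + l) k (mirror_cut j i t s) r.
Proof.
move=> /mirror_cuttable[c1 b1 b2] /mirror_cuttable[c2 b3 b4].
move=> /mirror_cuttable[c3 b5 b6] /mirror_cuttable[c4 b7 b8].
rewrite /mirror_cut in c2 b4 c4 b7 *.
have [s1 _] := size_cut c1; have [_ s2] := size_cut c3.
rewrite s1 in c2 b4 *; rewrite s2 in c4 b7 *.
set K := size (inp r) - k.+1 in c1 c2 c4 b4 *.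
set I := size (inp s) - i.+1 in c3 c4 b7 *.
set J := size (outp t) - j.+1 in c2 c3 c4 *.
set L := size (outp s) - l.+1 in c1 c2 *.
have eI : (size (inp r)).-1 + size (inp s) - (k + i).+1 = K + I by lia.
have eJ : (size (outp t)).-1 + size (outp s) - (j + l).+1 = J + L by lia.
by rewrite eI in c2 *; rewrite eJ in c4 *; apply: cut_assoc.
Qed.

Fact mirror_cut_interchange_inp j i l k t s r : i < k ->
  cuttable (P := mirror_polygraph) l k s r ->
  cuttable (P := mirror_polygraph) j i t (mirror_cut l k s r) ->
  cuttable (P := mirror_polygraph) j i t r ->
  cuttable (P := mirror_polygraph) l (k + size (rev (inp t))).-1 s
    (mirror_cut j i t r) ->
  mirror_cut j i t (mirror_cut l k s r) =
  mirror_cut l (k + size (rev (inp t))).-1 s (mirror_cut j i t r).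
Proof.
move=> ik /mirror_cuttable[c1 b1 b2] /mirror_cuttable[c2 b3 b4].
move=> /mirror_cuttable[c3 b5 b6] /mirror_cuttable[c4 b7 b8].
rewrite /mirror_cut size_rev in c2 b4 c4 b7 b8 *.
have [s1 _] := size_cut c1; have [s2 _] := size_cut c3.
rewrite s1 in c2 b4 *; rewrite s2 in c4 b8 *.
set K := size (inp r) - k.+1 in c1 c2 b4 *.
set I := size (inp r) - i.+1 in c3 c4 b8 *.
have t0 : 0 < size (inp t) by case: (inp t) (@inp_neq0 _ t).
have s0 : 0 < size (inp s) by case: (inp s) (@inp_neq0 _ s).
have eI : (size (inp r)).-1 + size (inp s) - i.+1 = (I + size (inp s)).-1.
  by lia.
have eK :
    (size (inp r)).-1 + size (inp t) - ((k + size (inp t)).-1).+1 = K by lia.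
(* Reversal turns i < k into K < I: the two cells exchange their roles. *)
rewrite eI in c2 *; rewrite eK in c4 *; symmetry.
by apply: cut_interchange_inp => //; lia.
Qed.

Fact mirror_cut_interchange_outp j i l k t s r : j < l ->
  cuttable (P := mirror_polygraph) l k t r ->
  cuttable (P := mirror_polygraph) j i (mirror_cut l k t r) s ->
  cuttable (P := mirror_polygraph) j i t s ->
  cuttable (P := mirror_polygraph) (l + size (rev (outp s))).-1 k
    (mirror_cut j i t s) r ->
  mirror_cut j i (mirror_cut l k t r) s =
  mirror_cut (l + size (rev (outp s))).-1 k (mirror_cut j i t s) r.
Proof.
move=> jl /mirror_cuttable[c1 b1 b2] /mirror_cuttable[c2 b3 b4].
move=> /mirror_cuttable[c3 b5 b6] /mirror_cuttable[c4 b7 b8].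
rewrite /mirror_cut size_rev in c2 b3 c4 b7 b8 *.
have [_ s1] := size_cut c1; have [_ s2] := size_cut c3.
rewrite s1 in c2 b3 *; rewrite s2 in c4 b7 *.
set L := size (outp t) - l.+1 in c1 c2 b3 *.
set J := size (outp t) - j.+1 in c3 c4 b7 *.
have s0 : 0 < size (outp s) by case: (outp s) (@outp_neq0 _ s).
have r0 : 0 < size (outp r) by case: (outp r) (@outp_neq0 _ r).
have eJ : (size (outp t)).-1 + size (outp r) - j.+1 = (J + size (outp r)).-1.
  by lia.
have eL :
    (size (outp t)).-1 + size (outp s) - ((l + size (outp s)).-1).+1 = L by lia.
rewrite eJ in c2 *; rewrite eL in c4 *; symmetry.
by apply: cut_interchange_outp => //; lia.
Qed.

Definition mirror : polybicategory :=
  @Polybicategory mirror_polygraph mirror_cut mirror_cut_boundary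
    mirror_cut_assoc mirror_cut_interchange_inp mirror_cut_interchange_outp.

Lemma mirror_cutE t s a A F G1 G2 D1 D2 :
  is_cell2 t A (D1 ++ a :: D2) -> is_cell2 s (G1 ++ a :: G2) F ->
  @cut mirror (size D2) (size G2) t s = cut (size D1) (size G1) t s.
Proof.
move=> [_ ho] [hi _]; rewrite /= /mirror_cut ho hi !size_cat /=.
by congr (cut _ _ _ _); lia.
Qed.

Lemma mirror_cell2_rev p G D :
  is_cell2 p G D <-> is_cell2 (P := mirror) p (rev G) (rev D).
Proof. by rewrite mirror_cell2 !revK. Qed.

Lemma mirror_universal_out t A b : is_cell2 t A [:: b] ->
  universal_out (X := X) 0 t <-> universal_out (X := mirror) 0 t.
Proof.
move=> ht; have ht' := (mirror_cell2_rev _ _ _).1 ht.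
have cutE G1 G2 D r : is_cell2 r (G1 ++ b :: G2) D ->
    @cut mirror 0 (size G2) t r = cut 0 (size G1) t r.
  exact: (mirror_cutE (D1 := [::]) (D2 := [::]) ht).
have cell G1 G2 D r : is_cell2 r (G1 ++ b :: G2) D <->
    is_cell2 (P := mirror) r (rev G2 ++ b :: rev G1) (rev D).
  by rewrite mirror_cell2_rev rev_cat rev_cons cat_rcons.
split=> ut.
  apply: (out_intro ht') => G1 G2 D.
    move=> s /mirror_cell2; rewrite !rev_cat revK -catA => hs.
    have [r hr ->] := out_factor ht ut hs; exists r.
      by move/cell: hr; rewrite !revK.
    by rewrite -(cutE _ _ _ _ hr) size_rev.
  rewrite -{1 2}(revK G1) -(revK G2) -(revK D).
  move=> r1 r2 /cell hr1 /cell hr2.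
  rewrite -(size_rev G1) (cutE _ _ _ _ hr1) (cutE _ _ _ _ hr2).
  exact: (out_inj ht ut hr1 hr2).
apply: (out_intro ht) => G1 G2 D.
  move=> s /mirror_cell2_rev; rewrite !rev_cat -catA => hs.
  have [r hr ->] := out_factor ht' ut hs; move/cell: hr => hr; exists r => //.
  by rewrite size_rev (cutE _ _ _ _ hr).
move=> r1 r2 hr1 hr2; rewrite -(cutE _ _ _ _ hr1) -(cutE _ _ _ _ hr2).
move/cell: hr1 => hr1; move/cell: hr2 => hr2; rewrite -(size_rev G2).
exact: (out_inj ht' ut hr1 hr2).
Qed.

Lemma mirror_universal_inpR t c a b : is_cell2 t [:: c; a] [:: b] ->
  universal_inp (X := X) 1 t <-> universal_inp (X := mirror) 0 t.
Proof.
move=> ht; have ht' := (mirror_cell2_rev _ _ _).1 ht.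
have cutE G D r : is_cell2 r G (a :: D) ->
    @cut mirror (size D) 0 r t = cut 0 1 r t.
  move=> hr.
  exact: (mirror_cutE (D1 := [::]) (G1 := [:: c]) (G2 := [::]) hr ht).
have cell G D r : is_cell2 r G (a :: D) <->
    is_cell2 (P := mirror) r (rev G) (rev D ++ [:: a]).
  by rewrite mirror_cell2_rev rev_cons cats1.
have rev0 G : G <> [::] -> rev G <> [::].
  by move=> G0 /(congr1 rev); rewrite revK.
split=> ut.
  apply: (inpL_intro ht') => G D.
    move=> s G0 /mirror_cell2; rewrite !rev_cat => hs.
    have [r hr ->] := inpR_factor ht ut (rev0 _ G0) hs; exists r.
      by move/cell: hr; rewrite !revK.
    by rewrite -(cutE _ _ _ hr) size_rev.
  rewrite -(revK G) -(revK D) => r1 r2 /cell hr1 /cell hr2.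
  rewrite size_rev (cutE _ _ _ hr1) (cutE _ _ _ hr2).
  exact: (inpR_inj ht ut hr1 hr2).
apply: (inpR_intro ht) => G D.
  move=> s G0 /mirror_cell2_rev; rewrite !rev_cons -!cats1 => hs.
  have [r hr ->] := inpL_factor ht' ut (rev0 _ G0) hs.
  move/cell: hr => hr; exists r => //.
  by rewrite size_rev (cutE _ _ _ hr).
move=> r1 r2 hr1 hr2; rewrite -(cutE _ _ _ hr1) -(cutE _ _ _ hr2).
move/cell: hr1 => hr1; move/cell: hr2 => hr2; rewrite -(size_rev D).
exact: (inpL_inj ht' ut hr1 hr2).
Qed.

Lemma mirror_universal_inpL t a c b : is_cell2 t [:: a; c] [:: b] ->
  universal_inp (X := X) 0 t <-> universal_inp (X := mirror) 1 t.
Proof.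
move=> ht; have ht' := (mirror_cell2_rev _ _ _).1 ht.
have cutE G D r : is_cell2 r G (D ++ [:: a]) ->
    @cut mirror 0 1 r t = cut (size D) 0 r t.
  move=> hr.
  exact: (mirror_cutE (D2 := [::]) (G1 := [::]) (G2 := [:: c]) hr ht).
have cell G D r : is_cell2 r G (D ++ [:: a]) <->
    is_cell2 (P := mirror) r (rev G) (a :: rev D).
  by rewrite mirror_cell2_rev rev_cat.
have rev0 G : G <> [::] -> rev G <> [::].
  by move=> G0 /(congr1 rev); rewrite revK.
split=> ut.
  apply: (inpR_intro ht') => G D.
    move=> s G0 /mirror_cell2; rewrite !rev_cons -!cats1 => hs.
    have [r hr ->] := inpL_factor ht ut (rev0 _ G0) hs; exists r.
      by move/cell: hr; rewrite !revK.
    by rewrite -(cutE _ _ _ hr).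
  rewrite -(revK G) -(revK D) => r1 r2 /cell hr1 /cell hr2.
  rewrite (cutE _ _ _ hr1) (cutE _ _ _ hr2).
  exact: (inpL_inj ht ut hr1 hr2).
apply: (inpL_intro ht) => G D.
  move=> s G0 /mirror_cell2_rev; rewrite !rev_cat => hs.
  have [r hr ->] := inpR_factor ht' ut (rev0 _ G0) hs.
  move/cell: hr => hr; exists r => //.
  by rewrite (cutE _ _ _ hr).
move=> r1 r2 hr1 hr2; rewrite -(cutE _ _ _ hr1) -(cutE _ _ _ hr2).
move/cell: hr1 => hr1; move/cell: hr2 => hr2.
exact: (inpR_inj ht' ut hr1 hr2).
Qed.

End Mirror.

Section MirrorStructure.
Variable X : polybicategory.

Lemma mirror_biuniversalR t c a b :
  [/\ is_cell2 (P := X) t [:: c; a] [:: b], universal_out (X := X) 0 t &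
      universal_inp (X := X) 1 t] <->
  [/\ is_cell2 (P := mirror X) t [:: a; c] [:: b],
      universal_out (X := mirror X) 0 t &
      universal_inp (X := mirror X) 0 t].
Proof.
split=> -[ht uo ui].
  by split; [apply/mirror_cell2 | apply/(mirror_universal_out ht) |
             apply/(mirror_universal_inpR ht)].
move/mirror_cell2: ht => ht.
by split=> //; [apply/(mirror_universal_out ht) |
                apply/(mirror_universal_inpR ht)].
Qed.

Lemma mirror_biuniversalL t a c b :
  [/\ is_cell2 (P := X) t [:: a; c] [:: b], universal_out (X := X) 0 t &
      universal_inp (X := X) 0 t] <->
  [/\ is_cell2 (P := mirror X) t [:: c; a] [:: b],
      universal_out (X := mirror X) 0 t &
      universal_inp (X := mirror X) 1 t].
Proof.
split=> -[ht uo ui].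
  by split; [apply/mirror_cell2 | apply/(mirror_universal_out ht) |
             apply/(mirror_universal_inpL ht)].
move/mirror_cell2: ht => ht.
by split=> //; [apply/(mirror_universal_out ht) |
                apply/(mirror_universal_inpL ht)].
Qed.

Lemma mirror_cell1 (a : cell1 X) x y :
  is_cell1 (P := mirror X) a x y <-> is_cell1 (P := X) a y x.
Proof. by split=> -[]. Qed.

Lemma mirror_tensor_unit x u :
  tensor_unit (X := X) x u <-> tensor_unit (X := mirror X) x u.
Proof.
split=> -[hu uL uR]; split.
- exact/mirror_cell1.
- by move=> y a /mirror_cell1/uR[r /mirror_biuniversalL]; exists r.
- by move=> y a /mirror_cell1/uL[l /mirror_biuniversalR]; exists l.
- exact/mirror_cell1.
- by move=> y a /mirror_cell1/uR[r /mirror_biuniversalR]; exists r.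
- by move=> y a /mirror_cell1/uL[l /mirror_biuniversalL]; exists l.
Qed.

Lemma mirror_left_universal e : tensor_right_universal (X := X) e <->
  tensor_left_universal (X := mirror X) e.
Proof.
split=> -[h1 h2]; split=> z a /mirror_cell1 ha.
- have [u [p [/mirror_cell1 hu hp uo ui]]] := h1 _ _ ha.
  by have [] := (mirror_biuniversalL _ _ _ _).1 (And3 hp uo ui); exists u, p.
- have [u [p [/mirror_cell1 hu hp uo ui]]] := h2 _ _ ha.
  by have [] := (mirror_biuniversalL _ _ _ _).1 (And3 hp uo ui); exists u, p.
- have [u [p [/mirror_cell1 hu hp uo ui]]] := h1 _ _ ha.
  by have [] := (mirror_biuniversalL _ _ _ _).2 (And3 hp uo ui); exists u, p.
- have [u [p [/mirror_cell1 hu hp uo ui]]] := h2 _ _ ha.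
  by have [] := (mirror_biuniversalL _ _ _ _).2 (And3 hp uo ui); exists u, p.
Qed.

Lemma mirror_right_universal e : tensor_left_universal (X := X) e ->
  tensor_right_universal (X := mirror X) e.
Proof.
move=> -[h1 h2]; split=> z a /mirror_cell1 ha.
- have [u [p [/mirror_cell1 hu hp uo ui]]] := h1 _ _ ha.
  by have [] := (mirror_biuniversalR _ _ _ _).1 (And3 hp uo ui); exists u, p.
- have [u [p [/mirror_cell1 hu hp uo ui]]] := h2 _ _ ha.
  by have [] := (mirror_biuniversalR _ _ _ _).1 (And3 hp uo ui); exists u, p.
Qed.

Lemma mirror_tensor_representable1 :
  tensor_representable1 X -> tensor_representable1 (mirror X).
Proof.
move=> [un tens]; split.
  move=> a; have [i [hi iR iL]] := un a; exists i; split.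
  - exact/mirror_cell2.
  - move=> j t /mirror_cuttable[+ _ _].
    by rewrite /= /mirror_cut hi.1; apply: iR.
  - move=> j t /mirror_cuttable[+ _ _].
    by rewrite /= /mirror_cut hi.2; apply: iL.
move=> x y z a b /mirror_cell1 ha /mirror_cell1 hb.
have [ab [t [hab ht ut]]] := tens _ _ _ _ _ hb ha.
exists ab, t; split; [exact/mirror_cell1 | exact/mirror_cell2 |].
exact/(mirror_universal_out ht).
Qed.

End MirrorStructure.

Theorem proposition3p17 (X : polybicategory) (hX : tensor_representable1 X)
    (x y : cell0 X) (e : cell1 X) (he : is_cell1 e x y) :
  tensor_universal e <->
  exists (ux uy : cell1 X) (e' : cell1 X) (p q : cell2 X),
    tensor_unit x ux /\ tensor_unit y uy /\ is_cell1 e' y x /\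
    (is_cell2 p [:: e; e'] [:: ux] /\ universal_out 0 p) /\
    (is_cell2 q [:: e'; e] [:: uy] /\ universal_out 0 q).
Proof.
split=> [eU | [ux [uy [e' [p [q [uxU [uyU [he' [[hp up] [hq uq]]]]]]]]]]].
  have [[eL _] [eR _]] := eU; have [se te] := he.
  have [ux [p [_ hp up up']]] := eR _ _ (conj erefl erefl).
  have [uy [q [_ hq uq _]]] := eL _ _ (conj erefl erefl).
  have uyU : tensor_unit (tgt e) uy.
    apply/mirror_tensor_unit.
    apply: (@tensor_unit_of_absorbed (mirror X) e uy q).
    - by split; [apply/mirror_left_universal; case: eU |
                 apply/mirror_right_universal; case: eU].
    - exact/mirror_cell2.
    - exact/(mirror_universal_out hq).
  have [e' [s [t [he' hs ht]]]] := inverse_of_universal eU uyU hp up up' hq uq.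
  exists ux, uy, e', s, t; rewrite -se -te; split=> //.
  exact: tensor_unit_of_absorbed eU hp up.
split.
  exact: (left_universal_of_inverse hX uxU uyU he he' hp up hq uq).
apply/mirror_left_universal.
apply: (@left_universal_of_inverse (mirror X) y x uy ux e e' q p).
- exact: mirror_tensor_representable1.
- exact: (mirror_tensor_unit _ _).1.
- exact: (mirror_tensor_unit _ _).1.
- exact/mirror_cell1.
- exact/mirror_cell1.
- exact/mirror_cell2.
- exact/(mirror_universal_out hq).
- exact/mirror_cell2.
- exact/(mirror_universal_out hp).
Qed.
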